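(* Let $f=\bigoplus_{0\le i\le d} f_i\otimes y^{\otimes i}$, where $f_0,\dots,f_d$ are tropical polynomials in the variables $x_1,\dots,x_n$ with integer coefficients. If the tropical Newton-Puiseux polynomials $\bigoplus_I a_I\otimes x^{\otimes I}$ and $\bigoplus_I b_I\otimes x^{\otimes I}$ are resolutions of $f$, then $\bigoplus_I (a_I\oplus b_I)\otimes x^{\otimes I}$ is also a resolution of $f$.
   Context: In the tropical semiring $\oplus$ denotes $\min$ and $\otimes$ denotes classical addition $+$; the tropical zero is $\infty$. A tropical polynomial in $x_1,\dots,x_n$ is a finite expression $\bigoplus_I a_I\otimes x^{\otimes I}$ with $I=(i_1,\dots,i_n)$ a multiindex of nonnegative integers, regarded as the function $\mathbf x\mapsto\min_I\{a_I+i_1x_1+\cdots+i_nx_n\}$ on $\mathbb{R}^n$. A tropical Newton-Puiseux polynomial is a finite nonempty expression $\bigoplus_I a_I\otimes x^{\otimes I}$ with $I\in\mathbb{Q}^n$, $a_I\in\mathbb{Q}$, regarded as a function in the same way; a coefficient outside the (finite) support is taken to be $\infty$. A tropical Newton-Puiseux polynomial $y$ is a resolution of $f$ if for every $\mathbf x\in\mathbb{R}^n$ the minimum of the values $f_i(\mathbf x)+i\cdot y(\mathbf x)$, $0\le i\le d$, is finite and is attained for at least two different indices $i$. *)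

(* Defs.v *)
From HB Require Import structures.
From mathcomp Require Import all_boot all_order all_algebra.
From mathcomp Require Import finmap.
From mathcomp Require Import all_classical reals constructive_ereal.

Set Implicit Arguments.
Unset Strict Implicit.
Unset Printing Implicit Defensive.

Import Order.TTheory GRing.Theory Num.Theory.

Local Open Scope fset_scope.
Local Open Scope ring_scope.

(* Coefficients are of type [option C], where [None] is the tropical zero,
   i.e., infinity. *)
Definition trop_add (C : realDomainType) (a b : option C) : option C :=
  match a, b with
  | None, _ => b
  | _, None => a
  | Some u, Some v => Some (Num.min u v)
  end.

(* The finite support [finsupp p] is exactly the set of exponents whose
   coefficient is not infinity; it may be empty. *)
Definition trop_expr (n : nat) (E : choiceType) (C : eqType) :=
  {fsfun 'rV[E]_n -> option C with None}.

Definition trop_eval (R : realType) (n : nat) (E : choiceType) (C : eqType)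
    (expR : E -> R) (coefR : C -> R) (p : trop_expr n E C) (x : 'rV[R]_n) :
    \bar R :=
  \big[mine/+oo%E]_(I <- finsupp p)
    (if p I is Some c
     then (coefR c + \sum_(j < n) expR (I ord0 j) * x ord0 j)%:E else +oo%E).

Definition trop_poly (n : nat) := trop_expr n nat int.

Definition trop_poly_eval (R : realType) (n : nat) (p : trop_poly n)
    (x : 'rV[R]_n) : \bar R :=
  trop_eval (fun k : nat => k%:R) (fun c : int => c%:~R) p x.

Record np_poly (n : nat) := NPPoly {
  np_coef :> trop_expr n rat rat;
  np_coef_neq0 : finsupp np_coef != fset0 }.

Definition np_eval (R : realType) (n : nat) (y : np_poly n)
    (x : 'rV[R]_n) : \bar R :=
  trop_eval (fun q : rat => ratr q) (fun c : rat => ratr c) y x.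

Definition trop_expr_add (n : nat) (E : choiceType) (C : realDomainType)
    (a b : trop_expr n E C) : trop_expr n E C :=
  [fsfun I in finsupp a `|` finsupp b => trop_add (a I) (b I)].

Lemma trop_expr_addE (n : nat) (E : choiceType) (C : realDomainType)
    (a b : trop_expr n E C) (I : 'rV[E]_n) :
  trop_expr_add a b I = trop_add (a I) (b I).
Proof.
rewrite fsfunE inE; case: ifPn => //; rewrite negb_or => /andP[aI bI].
by rewrite !fsfun_dflt.
Qed.

Lemma np_add_neq0 (n : nat) (a b : np_poly n) :
  finsupp (trop_expr_add a b) != fset0.
Proof.
have /fset0Pn[I] := np_coef_neq0 a; rewrite mem_finsupp => aI.
apply/fset0Pn; exists I; rewrite mem_finsupp trop_expr_addE.
by case: (np_coef a I) aI => // u _; case: (np_coef b I).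
Qed.

Definition np_add (n : nat) (a b : np_poly n) : np_poly n :=
  NPPoly (np_add_neq0 a b).

(* The value at [x] of the term f_i (x) y^i of f at [y]; [np_eval y x] is
   always finite, so the convention 0 * +oo = 0 plays no role. *)
Definition res_term (R : realType) (n d : nat) (f : 'I_d.+1 -> trop_poly n)
    (y : np_poly n) (x : 'rV[R]_n) (i : 'I_d.+1) : \bar R :=
  (trop_poly_eval (f i) x + (i%:R)%:E * np_eval y x)%E.

Definition resolution (R : realType) (n d : nat) (f : 'I_d.+1 -> trop_poly n)
    (y : np_poly n) : Prop :=
  forall x : 'rV[R]_n,
    let m := \big[mine/+oo%E]_(i < d.+1) res_term f y x i in
    m \is a fin_num /\
    exists i j : 'I_d.+1, [/\ i != j, res_term f y x i = m
                                    & res_term f y x j = m].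

(* Main.v *)
Require Import Defs.
From mathcomp Require Import all_boot all_order all_algebra.
From mathcomp Require Import finmap.
From mathcomp Require Import all_classical reals constructive_ereal.

(** Evaluation at a fixed point turns tropical addition of expressions into the
    minimum of the two values ([trop_eval_add]).  Since the extended reals are
    totally ordered, at each point [x] the value of [np_add a b] is therefore
    equal to that of [a] or to that of [b].  Being a resolution is a condition
    imposed point by point, and at [x] it depends on the candidate only through
    its value at [x]; so at each [x] the condition for [np_add a b] coincides with
    the condition for one of [a] and [b], which holds by hypothesis. *)

Set Implicit Arguments.
Unset Strict Implicit.
Unset Printing Implicit Defensive.

Import Order.TTheory GRing.Theory Num.Theory.

Local Open Scope fset_scope.
Local Open Scope ring_scope.

(** Exponents outside the support contribute +oo, the unit of the minimum.  This
    lets two expressions be evaluated over a common set of exponents. *)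
Lemma trop_eval_widen (R : realType) (n : nat) (E : choiceType) (C : eqType)
    (expR : E -> R) (coefR : C -> R) (p : trop_expr n E C) (x : 'rV[R]_n)
    (S : {fset 'rV[E]_n}) :
  finsupp p `<=` S ->
  trop_eval expR coefR p x =
  \big[mine/+oo%E]_(I <- S)
    (if p I is Some c
     then (coefR c + \sum_(j < n) expR (I ord0 j) * x ord0 j)%:E else +oo%E).
Proof.
move=> pS; apply: big_fset_incl => // I _ pI.
by rewrite fsfun_dflt.
Qed.

(** The two supports may overlap.  On a common exponent the smaller coefficient
    is kept, which yields the smaller of the two terms because [coefR] preserves
    the order and adding the same linear form to both sides does too. *)
Lemma trop_eval_add (R : realType) (n : nat) (E : choiceType)
    (C : realDomainType) (expR : E -> R) (coefR : C -> R)
    (a b : trop_expr n E C) (x : 'rV[R]_n) :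
  {homo coefR : u v / u <= v} ->
  trop_eval expR coefR (trop_expr_add a b) x =
  mine (trop_eval expR coefR a x) (trop_eval expR coefR b x).
Proof.
move=> coefR_mono; set S := finsupp a `|` finsupp b.
have abS : finsupp (trop_expr_add a b) `<=` S by exact: finsupp_sub.
rewrite (trop_eval_widen _ _ _ abS).
rewrite (trop_eval_widen _ _ _ (fsubsetUl _ _ : finsupp a `<=` S)).
rewrite (trop_eval_widen _ _ _ (fsubsetUr _ _ : finsupp b `<=` S)).
rewrite -big_split; apply: eq_bigr => I _ /=.
rewrite trop_expr_addE.
case: (a I) (b I) => [u|] [v|] /=; rewrite ?minye ?miney //.
rewrite -EFin_min -addr_minl; congr (_ + _)%:E.
case: (leP u v) => [uv|/ltW vu].
  by rewrite min_l ?coefR_mono.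
by rewrite min_r ?coefR_mono.
Qed.

Lemma np_eval_add (R : realType) (n : nat) (a b : np_poly n) (x : 'rV[R]_n) :
  np_eval (np_add a b) x = mine (np_eval a x) (np_eval b x).
Proof. by apply: trop_eval_add => u v uv; rewrite ler_rat. Qed.

Lemma eq_res_term (R : realType) (n d : nat) (f : 'I_d.+1 -> trop_poly n)
    (y z : np_poly n) (x : 'rV[R]_n) :
  np_eval y x = np_eval z x -> res_term f y x = res_term f z x.
Proof. by move=> yz; apply/funext => i; rewrite /res_term yz. Qed.

Theorem proposition1p6 (R : realType) (n d : nat) (f : 'I_d.+1 -> trop_poly n)
    (a b : np_poly n) :
  resolution R f a -> resolution R f b -> resolution R f (np_add a b).
Proof.
move=> fa fb x; have abE := np_eval_add a b x.
have [ab|ba] := leP (np_eval a x) (np_eval b x).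
  by rewrite (eq_res_term f (z := a)) ?abE ?min_l //; exact: fa.
by rewrite (eq_res_term f (z := b)) ?abE ?min_r ?(ltW ba) //; exact: fb.
Qed.
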